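(* Let $q$ be a prime power and let $n=q^2+q+1$. Then the code $\mathcal{D}\subseteq \mathrm{U}(n,\mathbb{F}_q)$ given by Construction C (described in the context, for any admissible choice of the points $P_i$, $Q_i$ and representatives $u_i$, $v_i$) is a non-trivial perfect linear flag-rank-metric code with minimum distance $3$ and codimension $3$.
   Context: $\mathbb{F}_q$ is the finite field with $q$ elements. $\mathrm{U}(n,\mathbb{F}_q)$ is the $\mathbb{F}_q$-vector space of $n\times n$ upper triangular matrices over $\mathbb{F}_q$; it has dimension $\frac{n(n+1)}{2}$. For $M\in \mathrm{U}(n,\mathbb{F}_q)$ and $1\le i\le n$, $M_{[i]}$ is the $i\times(n-i+1)$ submatrix of $M$ obtained by deleting the first $i-1$ columns and the last $n-i$ rows (i.e. rows $1,\dots,i$ and columns $i,\dots,n$). The flag-rank weight of $M$ is $\mathrm{fr}(M)=\sum_{i=1}^{n}\mathrm{rk}(M_{[i]})$; the flag-rank distance is $\mathrm{d}_{\mathrm{fr}}(A,B)=\mathrm{fr}(A-B)$. A linear flag-rank-metric code is an $\mathbb{F}_q$-subspace $\mathcal{C}$ of $\mathrm{U}(n,\mathbb{F}_q)$; its minimum (flag-rank) distance, defined when $\mathcal{C}\neq\{\boldsymbol{0}\}$, is $\delta=\min\{\mathrm{fr}(M):M\in\mathcal{C}\setminus\{\boldsymbol{0}\}\}$. Its codimension is $\frac{n(n+1)}{2}-\dim_{\mathbb{F}_q}(\mathcal{C})$. Let $b_q(n,t)=|\{A\in \mathrm{U}(n,\mathbb{F}_q):\mathrm{fr}(A)\le t\}|$.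 A code $\mathcal{C}$ with minimum distance $\delta$ is perfect if $|\mathcal{C}|\,b_q(n,t)=q^{\frac{n(n+1)}{2}}$, where $t=\left\lfloor\frac{\delta-1}{2}\right\rfloor$; it is non-trivial if $\mathcal{C}\ne \mathrm{U}(n,\mathbb{F}_q)$. Construction C. Let $3\le n\le q^2+q+1$. Let $D_2(n,\mathbb{F}_q)=\{A\in \mathrm{U}(n,\mathbb{F}_q): a_{i,j}=0 \text{ whenever } j-i\ge 2\}$, and identify it with $\mathbb{F}_q^{2n-1}$ via the linear isomorphism \[ \rho\left(\sum_{i=1}^{n}\lambda_iE_i+\sum_{i=1}^{n-1}\mu_iF_i\right)=(\lambda_1,\mu_1,\lambda_2,\ldots,\mu_{n-1},\lambda_n), \] where $E_i$ (resp. $F_i$) is the matrix with entry $1$ in position $(i,i)$ (resp. $(i,i+1)$) and $0$ elsewhere. Let $\mathrm{PG}(2,q)$ be the projective plane with underlying vector space $\mathbb{F}_q^3$, and write $[u]$ for the point spanned by a nonzero vector $u$. Choose distinct points $P_i=[u_i]\in\mathrm{PG}(2,q)$ for $i=1,\dots,n$, and points $Q_i=[v_i]\in\mathrm{PG}(2,q)$ with $Q_i\notin\langle P_i,P_{i+1}\rangle$ (the line through $P_i$ and $P_{i+1}$) for $i=1,\dots,n-1$. Let $H=(u_1\mid v_1\mid u_2\mid v_2\mid\cdots\mid v_{n-1}\mid u_n)$ be the $3\times(2n-1)$ matrix over $\mathbb{F}_q$ with these columns, let $D=\ker(H)=\{x\in\mathbb{F}_q^{2n-1}:Hx^{\top}=0\}$,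 and define \[ \mathcal{D}:=\rho^{-1}(D)\oplus \overline{U}(n-2,\mathbb{F}_q)\subseteq \mathrm{U}(n,\mathbb{F}_q), \] where $\overline{U}(n-2,\mathbb{F}_q)=\{A\in \mathrm{U}(n,\mathbb{F}_q): a_{i,j}=0 \text{ unless } j-i\ge 2\}$ is the space of matrices supported on the diagonals strictly above the first superdiagonal. *)

(* Defs.v *)
From HB Require Import structures.
From mathcomp Require Import all_boot all_order all_algebra.
Set Implicit Arguments.
Unset Strict Implicit.
Unset Printing Implicit Defensive.
Import GRing.Theory.
Local Open Scope ring_scope.

(* Row and column indices start at 0, so the M_[i] of the literature is       *)
(* flag_sub M (i - 1).                                                        *)

Lemma flag_col_subproof n (i : 'I_n) (c : 'I_(n - i)) : (i + c < n)%N.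
Proof. by rewrite -ltn_subRL. Qed.

Definition flag_col n (i : 'I_n) (c : 'I_(n - i)) : 'I_n :=
  Ordinal (flag_col_subproof c).

Lemma ord_succ_subproof n (i : 'I_n.-1) : (i.+1 < n)%N.
Proof. by case: n i => [[]|n i] //=; rewrite ltnS. Qed.

(* For i : 'I_n.-1, ord_cur i and ord_succ i are i and i + 1 seen in 'I_n.    *)
Definition ord_cur n (i : 'I_n.-1) : 'I_n := widen_ord (leq_pred n) i.
Definition ord_succ n (i : 'I_n.-1) : 'I_n := Ordinal (ord_succ_subproof i).

Lemma diag_idx_subproof n (i : 'I_n) : (2 * i < (2 * n).-1)%N.
Proof.
case: n i => [[]|n i] //.
by rewrite [(2 * n.+1)%N]mulnS add2n /= ltnS leq_pmul2l // -ltnS.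
Qed.

Lemma sup_idx_subproof n (i : 'I_n.-1) : ((2 * i).+1 < (2 * n).-1)%N.
Proof.
case: n i => [[]|n i] //.
by rewrite [(2 * n.+1)%N]mulnS add2n /= ltnS ltn_pmul2l.
Qed.

(* Positions of lambda_(i+1) and of mu_(i+1) in                               *)
(* (lambda_1, mu_1, lambda_2, ..., mu_(n-1), lambda_n).                       *)
Definition diag_idx n (i : 'I_n) : 'I_(2 * n).-1 := Ordinal (diag_idx_subproof i).
Definition sup_idx n (i : 'I_n.-1) : 'I_(2 * n).-1 := Ordinal (sup_idx_subproof i).

Section FlagRank.

Variable F : finFieldType.

Section Code.

Variable n : nat.
Implicit Types (M A : 'M[F]_n) (C : {vspace 'M[F]_n}) (P : rel 'I_n).

Definition flag_sub M (i : 'I_n) : 'M[F]_(i.+1, n - i) :=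
  mxsub (widen_ord (ltn_ord i)) (@flag_col n i) M.

Definition fr M : nat := (\sum_(i < n) \rank (flag_sub M i))%N.

Definition supported_on P : {vspace 'M[F]_n} :=
  (\sum_(ij : 'I_n * 'I_n | P ij.1 ij.2) <[delta_mx ij.1 ij.2]>)%VS.

Lemma supported_onP P A :
  reflect (forall i j, ~~ P i j -> A i j = 0) (A \in supported_on P).
Proof.
apply: (iffP memv_sumP) => [[B BP ->] i j nP|A0].
  rewrite summxE big1 // => -[k l] /= Pkl.
  have /vlineP[a ->] := BP (k, l) Pkl; rewrite !mxE /=.
  case: eqP => [ik|]; last by rewrite mulr0.
  by case: eqP => [jl|]; [rewrite ik jl Pkl in nP | rewrite mulr0].
exists (fun ij => A ij.1 ij.2 *: delta_mx ij.1 ij.2) => [ij _|].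
  exact/memvZ/memv_line.
rewrite {1}(matrix_sum_delta A) pair_big /= [LHS](bigID (fun ij => P ij.1 ij.2)) /=.
by rewrite [X in _ + X]big1 ?addr0 // => ij /A0->; rewrite scale0r.
Qed.

(* U(n, F), D_2(n, F) and \overline{U}(n - 2, F). *)
Definition upper : {vspace 'M[F]_n} := supported_on (fun i j => i <= j)%N.
Definition bidiag : {vspace 'M[F]_n} :=
  supported_on (fun i j => i <= j < i + 2)%N.
Definition far_upper : {vspace 'M[F]_n} :=
  supported_on (fun i j => i + 2 <= j)%N.

Definition flag_rank_code C : bool := (C <= upper)%VS.

(* Only meaningful for C != 0, in which case vpick C is a nonzero codeword. *)
Definition min_dist C : nat :=
  fr [arg min_(M < vpick C | (M \in C) && (M != 0)) fr M].

Lemma min_distP C d : C != 0%VS ->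
  min_dist C = d <->
    (exists2 M, (M \in C) && (M != 0) & fr M = d) /\
    (forall M, M \in C -> M != 0 -> (d <= fr M)%N).
Proof.
move=> C0; rewrite /min_dist; case: arg_minnP => [|M MC Mmin].
  by rewrite memv_pick vpick0.
split=> [<-|[[N NC <-] dmin]].
  by split=> [|N NC N0]; [exists M | apply: Mmin; rewrite NC].
apply/eqP; rewrite eqn_leq Mmin //=.
by case/andP: MC => MC M0; apply: dmin.
Qed.

Definition codim C : nat := ((n * (n + 1)) %/ 2 - \dim C)%N.

Definition ball_size (t : nat) : nat :=
  #|[set A : 'M[F]_n | (A \in upper) && (fr A <= t)%N]|.

Definition perfect C : Prop :=
  C != 0%VS /\
  (#|[set M : 'M[F]_n | M \in C]| * ball_size ((min_dist C - 1) %/ 2)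
     = #|F| ^ ((n * (n + 1)) %/ 2))%N.

Definition nontrivial C : bool := C != upper.

End Code.

Section ConstructionC.

Variables (n : nat) (u : 'I_n -> 'cV[F]_3) (v : 'I_n.-1 -> 'cV[F]_3).

(* rho is only an isomorphism on bidiag; here it is extended to all matrices  *)
(* by ignoring the entries off the two diagonals.                             *)
Definition rho (A : 'M[F]_n) : 'rV[F]_(2 * n).-1 :=
  \sum_(i < n) A i i *: delta_mx 0 (diag_idx i)
  + \sum_(i < n.-1) A (ord_cur i) (ord_succ i) *: delta_mx 0 (sup_idx i).

(* The matrix (u_1 | v_1 | u_2 | ... | v_(n-1) | u_n). *)
Definition Hmx : 'M[F]_(3, (2 * n).-1) :=
  \sum_(i < n) u i *m delta_mx 0 (diag_idx i)
  + \sum_(i < n.-1) v i *m delta_mx 0 (sup_idx i).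

Definition kerH : {vspace 'rV[F]_(2 * n).-1} :=
  lker (linfun (fun x : 'rV[F]_(2 * n).-1 => Hmx *m x^T)).

Fact rho_is_linear : linear rho.
Proof.
move=> a A B; rewrite /rho scalerDr addrACA; congr (_ + _);
  by rewrite scaler_sumr -big_split; apply: eq_bigr => i _;
     rewrite !mxE scalerDl scalerA.
Qed.
HB.instance Definition _ := GRing.isLinear.Build F _ _ _ rho rho_is_linear.

Lemma col_Hmx_diag i : col (diag_idx i) Hmx = u i.
Proof.
apply/matrixP=> r c; rewrite ord1 !mxE !summxE (bigD1 i) //= !mxE big_ord1 mxE.
rewrite !eqxx mulr1 !big1 ?addr0 // => j => [_|ji];
  rewrite mxE big_ord1 mxE eqxx /= -val_eqE /=.
  suff -> : (2 * i == (2 * j).+1)%N = false by rewrite mulr0.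
  by apply/eqP => /(congr1 odd); rewrite /= !oddM.
by rewrite eqn_mul2l /= val_eqE eq_sym (negPf ji) mulr0.
Qed.

Lemma col_Hmx_sup i : col (sup_idx i) Hmx = v i.
Proof.
apply/matrixP=> r c; rewrite ord1 !mxE !summxE addrC (bigD1 i) //= !mxE big_ord1 mxE.
rewrite !eqxx mulr1 !big1 ?addr0 // => j => [_|ji];
  rewrite mxE big_ord1 mxE eqxx /= -val_eqE /=.
  suff -> : ((2 * i).+1 == 2 * j)%N = false by rewrite mulr0.
  by apply/eqP => /(congr1 odd); rewrite /= !oddM.
by rewrite eqSS eqn_mul2l /= val_eqE eq_sym (negPf ji) mulr0.
Qed.

Lemma mem_kerH x : (x \in kerH) = (Hmx *m x^T == 0).
Proof.
have lin : linear (fun x : 'rV[F]_(2 * n).-1 => Hmx *m x^T).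
  by move=> a y z; rewrite linearP /= mulmxDr scalemxAr.
pose f : {linear _ -> _} := HB.pack (fun x : 'rV[F]_(2 * n).-1 => Hmx *m x^T)
  (GRing.isLinear.Build F _ _ _ _ lin).
by rewrite memv_ker (lfunE f).
Qed.

(* The point [w] of PG(2, q) is the vector line <[w]>, and the line through   *)
(* two distinct points is their sum as subspaces.                             *)
Definition admissible : Prop :=
  [/\ forall i, u i != 0,
      forall i, v i != 0,
      injective (fun i => <[u i]>%VS) &
      forall i : 'I_n.-1,
        ~~ (<[v i]> <= <[u (ord_cur i)]> + <[u (ord_succ i)]>)%VS].

Definition constructionC : {vspace 'M[F]_n} :=
  (bidiag n :&: linfun rho @^-1: kerH + far_upper n)%VS.

Lemma constructionC_direct :
  (bidiag n :&: linfun rho @^-1: kerH :&: far_upper n = 0)%VS.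
Proof.
apply/eqP; rewrite -subv0; apply/subvP => A.
rewrite memv_cap memv0 => /andP[/memv_capP[/supported_onP Ab _] /supported_onP Af].
apply/eqP/matrixP => i j; rewrite mxE.
have [ij|ij] := leqP (i + 2) j; last by apply: Af; rewrite -ltnNge.
by apply: Ab; rewrite ltnNge ij andbF.
Qed.

End ConstructionC.

End FlagRank.

(* Main.v *)
(* The code is the kernel of the syndrome map A |-> H (rho A)^T on U(n, F), which
   is onto F^3 because u_1, v_1, u_2 span F^3; this gives the codimension.  If
   A i j is nonzero then so is every flag submatrix of index between i and j, so
   a matrix of flag rank at most 2 is supported on two diagonal positions or on
   (k, k), (k, k+1), (k+1, k+1).  If it is nonzero, its syndrome vanishes only
   when two of the P_i coincide or Q_k lies on the line P_k P_(k+1).  The matrix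
   unit in position (1, 3) has flag rank 3 and lies in the code.  The ball of
   radius 1 consists of the multiples of the n diagonal matrix units, so it has
   1 + n (q - 1) = q^3 elements. *)
Require Import Defs.
From HB Require Import structures.
From mathcomp Require Import all_boot all_order all_algebra.
From mathcomp Require Import finfield zify.
Set Implicit Arguments.
Unset Strict Implicit.
Unset Printing Implicit Defensive.
Import GRing.Theory.
Local Open Scope ring_scope.

(** * Flag rank versus single entries *)

Lemma card_ord_interval n (i j : 'I_n) :
  #|[set k : 'I_n | (i <= k <= j)%N]| = (j.+1 - i)%N.
Proof.
rewrite cardE -(size_map val) -(size_iota i (j.+1 - i)); apply: perm_size.
apply: uniq_perm; rewrite ?iota_uniq ?(map_inj_uniq val_inj) ?enum_uniq // => /= k.
rewrite mem_iota; apply/mapP/idP => [[l] | kij].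
  by rewrite mem_enum inE => lij -> /=; lia.
have kn : (k < n)%N by have := ltn_ord j; lia.
by exists (Ordinal kn); rewrite // mem_enum inE /=; lia.
Qed.

Section FlagRank.

Variables (F : finFieldType) (n : nat).
Implicit Types (A M : 'M[F]_n) (i j k : 'I_n).

(** Each of these indices contributes at least 1 to [fr M], so lower bounds on flag rank reduce to
    counting indices. *)
Definition flag_supp M : {set 'I_n} := [set k | flag_sub M k != 0].

(** [flag_sub M k] keeps rows up to [k] and columns from [k] on, so it contains the entry at
    [(i, j)], in its column [j - k]. *)
Lemma mem_flag_supp M i j k : M i j != 0 -> (i <= k <= j)%N -> k \in flag_supp M.
Proof.
move=> Mij /andP[ik kj]; rewrite inE; apply: contraNneq Mij => /matrixP M0.
have jk : (j - k < n - k)%N by have := ltn_ord j; lia.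
have := M0 (Ordinal (ik : (i < k.+1)%N)) (Ordinal jk); rewrite !mxE => <-.
by apply/eqP; congr (M _ _); apply: val_inj => /=; lia.
Qed.

Lemma card_flag_supp M : (#|flag_supp M| <= fr M)%N.
Proof.
rewrite -sum1_card /fr big_mkcond; apply: leq_sum => k _.
by rewrite inE -mxrank_eq0 -lt0n; case: ltnP.
Qed.

Lemma flag_rank_ge_interval M i j : M i j != 0 -> (j.+1 - i <= fr M)%N.
Proof.
move=> Mij; apply: leq_trans (card_flag_supp M).
rewrite -card_ord_interval; apply/subset_leq_card/subsetP => k.
by rewrite inE; apply: mem_flag_supp Mij.
Qed.

Lemma fr0 : fr (0 : 'M[F]_n) = 0%N.
Proof.
by apply: big1 => k _; apply/eqP; rewrite mxrank_eq0; apply/eqP/matrixP=> r c; rewrite !mxE.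
Qed.

(** Only flag submatrices of index between [i] and [j] see the entry, and each of them is a multiple
    of a matrix unit, of rank at most 1. *)
Lemma fr_scale_delta (a : F) i j : (fr (a *: delta_mx i j) <= j.+1 - i)%N.
Proof.
rewrite -card_ord_interval -sum1_card big_mkcond; apply: leq_sum => k _.
rewrite inE; case: ifPn => [/andP[ik kj]|kij].
  have jk : (j - k < n - k)%N by have := ltn_ord j; lia.
  suff ->: flag_sub (a *: delta_mx i j) k
      = a *: delta_mx (Ordinal (ik : (i < k.+1)%N)) (Ordinal jk).
    by rewrite (leq_trans (mxrank_scale _ _)) ?mxrank_delta.
  apply/matrixP => r c; rewrite !mxE -!val_eqE /=.
  by congr (_ * (_ && _)%:R); apply/eqP/eqP; lia.
rewrite leqn0 mxrank_eq0; apply/eqP/matrixP => r c; rewrite !mxE -!val_eqE /=.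
suff /negPf-> : ~~ (((r : nat) == i) && (k + c == j)%N) by rewrite mulr0.
apply: contra kij => /andP[/eqP <- /eqP <-]; have := ltn_ord r; lia.
Qed.

(** * Dimensions of support spaces and the ball of radius 1 *)

Lemma supported_on_delta (P : rel 'I_n) i j :
  P i j -> (delta_mx i j : 'M[F]_n) \in supported_on F P.
Proof.
move=> Pij; apply/supported_onP => k l; rewrite mxE.
by case: eqP => // ->; case: eqP => // ->; rewrite Pij.
Qed.

Lemma dim_supported_on (P : rel 'I_n) :
  \dim (supported_on F P) = #|[pred ij : 'I_n * 'I_n | P ij.1 ij.2]|.
Proof.
have dx : directv (\sum_(ij : 'I_n * 'I_n | P ij.1 ij.2)
    <[delta_mx ij.1 ij.2 : 'M[F]_n]>)%VS.
  apply/directv_sum_independent => A Aline A0 [i j] /= Pij.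
  have /vlineP[a Aij] := Aline (i, j) Pij.
  suff a0 : a = 0 by rewrite Aij a0 scale0r.
  (* Reading the vanishing sum at position [(i, j)] isolates the coefficient [a]. *)
  have /matrixP/(_ i j) := A0; rewrite summxE (bigD1 (i, j)) //= big1 => [|[k l]].
    by rewrite addr0 Aij !mxE !eqxx mulr1.
  case/andP => Pkl; rewrite xpair_eqE /= negb_and => kl.
  have /vlineP[b ->] := Aline (k, l) Pkl; rewrite !mxE /= ![_ == i]eq_sym ![_ == j]eq_sym in kl *.
  by case: eqP kl => [|_]; case: eqP => //= *; rewrite mulr0.
rewrite /supported_on (directvP dx) /= -sum1_card; apply: eq_bigr => ij _.
rewrite dim_vline; case: eqP => // /matrixP/(_ ij.1 ij.2)/eqP.
by rewrite !mxE !eqxx oner_eq0.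
Qed.

Lemma dim_upper : \dim (upper F n) = ((n * (n + 1)) %/ 2)%N.
Proof.
rewrite dim_supported_on -sum1_card.
rewrite -(pair_big_dep predT (fun i j => (i <= j)%N) (fun _ _ => 1%N)) /=.
rewrite (exchange_big_dep predT) //=.
rewrite (eq_bigr (fun j : 'I_n => j.+1)) => [|j _].
  have := bin2_sum n.+1; rewrite bin2 big_nat_recl // add0n big_mkord => ->.
  by rewrite divn2 addn1 mulnC.
(* The rows of column [j] on or above the diagonal form the interval from 0 to [j]; the ordinal 0
   exists because [j] inhabits ['I_n]. *)
rewrite -(subn0 j.+1) -(card_ord_interval (Ordinal (leq_ltn_trans (leq0n j) (ltn_ord j)))).
by rewrite -sum1_card; apply: eq_bigl => i; rewrite inE.
Qed.

(** A nonzero entry off the diagonal, or two on it, would put two indices into [flag_supp A]. *)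
Lemma fr_le1E A : (A \in upper F n) && (fr A <= 1)%N =
  ((A == 0) || [exists k, exists a : F, (a != 0) && (A == a *: delta_mx k k)]).
Proof.
apply/andP/orP => [[/supported_onP Au A1]|[/eqP->|]]; last 2 first.
- by rewrite mem0v fr0.
- case/existsP => k /existsP[a /andP[_ /eqP->]]; split.
    by apply/memvZ/supported_on_delta.
  by rewrite (leq_trans (fr_scale_delta _ _ _)) // subSnn.
have [->|A0] := eqVneq A 0; [by left | right].
have /matrix0Pn[i [j Aij]] := A0.
have diag k l : A k l != 0 -> k = l.
  move=> Akl; apply/val_inj/eqP; rewrite eqn_leq.
  rewrite (contraR (fun h => introT eqP (Au k l h)) Akl) /=.
  by have := leq_trans (flag_rank_ge_interval Akl) A1; lia.
apply/existsP; exists i; apply/existsP; exists (A i i).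
have Aii := Aij; rewrite -(diag _ _ Aij) in Aii; rewrite Aii; apply/eqP/matrixP => k l.
rewrite !mxE; have [Akl|Akl] := eqVneq (A k l) 0.
  have [ki|_] := eqVneq k i; have [li|_] := eqVneq l i; rewrite ?mulr0 //.
  by rewrite mulr1 ki li.
have kl := diag _ _ Akl; subst l.
suff -> : k = i by rewrite !eqxx mulr1.
apply: (card_le1_eqP (leq_trans (card_flag_supp A) A1)).
  by apply: (mem_flag_supp Aii); rewrite leqnn.
by apply: (mem_flag_supp Akl); rewrite leqnn.
Qed.

Lemma ball_size1 : ball_size F n 1 = (n * (#|F| - 1)).+1.
Proof.
(* Pairs of a diagonal position and a nonzero scalar parametrize the nonzero matrices of the
   ball. *)
pose D := setX [set: 'I_n] [set~ (0 : F)].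
pose f (ka : 'I_n * F) := ka.2 *: delta_mx ka.1 ka.1 : 'M[F]_n.
have inj_f : {in D &, injective f}.
  move=> [k a] [l b]; rewrite !inE /= => a0 b0 /matrixP eq_f.
  have := eq_f k k; rewrite !mxE !eqxx mulr1 /=.
  have [-> -> |] := eqVneq k l; first by rewrite mulr1.
  by move=> _ /eqP; rewrite mulr0 (negPf a0).
rewrite /ball_size (_ : [set _ | _] = 0 |: f @: D).
  rewrite cardsU1 (_ : 0 \notin _) /=.
    by rewrite card_in_imset // cardsX cardsT card_ord cardsC1 subn1.
  apply/imsetP => -[[k a]]; rewrite !inE /= => a0 /esym/matrixP/(_ k k)/eqP.
  by rewrite !mxE !eqxx mulr1 (negPf a0).
apply/setP => A; rewrite inE fr_le1E !inE; congr (_ || _).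
apply/existsP/imsetP => [[k /existsP[a /andP[a0 /eqP->]]]|[[k a]]].
  by exists (k, a); rewrite // !inE.
by rewrite !inE /= => a0 ->; exists k; apply/existsP; exists a; rewrite a0 eqxx.
Qed.

End FlagRank.

(** * The code as the kernel of a syndrome map *)

Section ConstructionC.

Variables (F : finFieldType) (n : nat).
Variables (u : 'I_n -> 'cV[F]_3) (v : 'I_n.-1 -> 'cV[F]_3).
Implicit Types A M : 'M[F]_n.

(** This is [Hmx u v *m (rho A)^T] freed of the interleaved coordinates. *)
Definition syndrome A : 'cV[F]_3 :=
  \sum_(i < n) A i i *: u i + \sum_(i < n.-1) A (ord_cur i) (ord_succ i) *: v i.

Fact syndrome_is_linear : linear syndrome.
Proof.
move=> a A B; rewrite /syndrome scalerDr addrACA; congr (_ + _);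
  by rewrite scaler_sumr -big_split; apply: eq_bigr => i _;
     rewrite !mxE scalerDl scalerA.
Qed.
HB.instance Definition _ := GRing.isLinear.Build F _ _ _ syndrome syndrome_is_linear.

Lemma mulmx_Hmx_rho A : Hmx u v *m (rho A)^T = syndrome A.
Proof.
rewrite /rho /syndrome linearD /= mulmxDr !(linear_sum (@trmx F _ _)) /= !mulmx_sumr.
congr (_ + _); apply: eq_bigr => i _.
  by rewrite linearZ /= trmx_delta -scalemxAr -colE col_Hmx_diag.
by rewrite linearZ /= trmx_delta -scalemxAr -colE col_Hmx_sup.
Qed.

(** Since [syndrome] kills [far_upper], the condition on the two diagonals and the free far part
    merge into one kernel condition on [upper]. *)
Lemma mem_constructionC A :
  (A \in constructionC u v) = (A \in upper F n) && (syndrome A == 0).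
Proof.
have memB B : (B \in (linfun (@rho F n) @^-1: kerH u v)%VS) = (syndrome B == 0).
  by rewrite -memv_preim lfunE mem_kerH mulmx_Hmx_rho.
have syndrome_far B : B \in far_upper F n -> syndrome B = 0.
  move/supported_onP => Bfar; rewrite /syndrome !big1 ?addr0 // => i _;
    by rewrite Bfar ?scale0r //= -ltnNge addn2.
apply/memv_addP/andP => [[B]|[/supported_onP Au /eqP A0]].
  rewrite memv_cap memB => /andP[/supported_onP Bb /eqP B0] [N Nfar ->].
  rewrite linearD /= B0 (syndrome_far N) // addr0; split=> //.
  move/supported_onP: Nfar => Nfar.
  apply/supported_onP => i j ij; rewrite mxE Bb ?Nfar ?addr0 //; lia.
(* The far part of [A]; removing it leaves a bidiagonal matrix with the same syndrome. *)
pose N : 'M[F]_n := \matrix_(i, j) (if (i + 2 <= j)%N then A i j else 0).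
have Nfar : N \in far_upper F n.
  by apply/supported_onP => i j /negPf ij; rewrite mxE ij.
exists (A - N); last by exists N => //; rewrite subrK.
rewrite memv_cap memB linearB /= A0 syndrome_far // subr0 eqxx andbT.
apply/supported_onP => i j ij; rewrite !mxE; case: ifPn => ij2; first by rewrite subrr.
by rewrite subr0 Au //; lia.
Qed.

(** * Projective geometry: codimension and minimum distance *)

Hypothesis uv : admissible u v.

(** A nonzero vector of a vector line spans it, so both vectors give the same projective point. *)
Lemma admissible_colinear i j : u i \in <[u j]>%VS -> i = j.
Proof.
case: uv => u0 _ inj_u _ uij; apply: inj_u.
by apply/eqP; rewrite eqEdim -memvE uij !dim_vline !u0.
Qed.

Lemma free_admissible i : free [:: v i; u (ord_cur i); u (ord_succ i)].
Proof.
case: uv => u0 _ _ vline.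
rewrite !free_cons !span_cons span_nil addv0 memvE vline memv0 u0 nil_free !andbT /=.
by apply/negP => /admissible_colinear/(congr1 val)/= /n_Sn.
Qed.

Lemma syndrome_diag k (a : F) : syndrome (a *: delta_mx k k) = a *: u k.
Proof.
rewrite linearZ /=; congr (_ *: _); rewrite /syndrome (bigD1 k) //= !mxE !eqxx scale1r.
rewrite !big1 ?addr0 // => [i _|i /negPf ik]; last by rewrite mxE ik scale0r.
rewrite mxE -!val_eqE /=; have [->|_] := eqVneq (i : nat) k; last by rewrite scale0r.
by rewrite gtn_eqF ?scale0r.
Qed.

Lemma syndrome_sup k (a : F) :
  syndrome (a *: delta_mx (ord_cur k) (ord_succ k)) = a *: v k.
Proof.
rewrite linearZ /=; congr (_ *: _); rewrite /syndrome addrC (bigD1 k) //= !mxE !eqxx scale1r.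
rewrite !big1 ?addr0 // => [i _|i /negPf ik]; rewrite mxE -!val_eqE /=.
  have [->|_] := eqVneq (i : nat) k; last by rewrite scale0r.
  by rewrite ltn_eqF ?scale0r.
by rewrite val_eqE ik scale0r.
Qed.

Lemma syndrome_surjective : (1 < n)%N -> (linfun syndrome @: upper F n)%VS = fullv.
Proof.
move=> n1; have n0 : (0 < n.-1)%N by lia.
pose i := Ordinal n0; pose X := [:: v i; u (ord_cur i); u (ord_succ i)].
have fX : free X := free_admissible i.
suff XS : (<<X>> <= linfun syndrome @: upper F n)%VS.
  apply/eqP; rewrite eqEsubv subvf (subv_trans _ XS) //.
  by have /eqP-> : <<X>>%VS == fullv by rewrite eqEdim subvf dimvf (eqnP fX).
apply/span_subvP => w; rewrite !inE => /or3P[] /eqP->; rewrite -[X in X \in _]scale1r.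
- by rewrite -syndrome_sup -lfunE memv_img // memvZ // supported_on_delta /=.
- by rewrite -syndrome_diag -lfunE memv_img // memvZ // supported_on_delta.
- by rewrite -syndrome_diag -lfunE memv_img // memvZ // supported_on_delta.
Qed.

(** Rank-nullity for [syndrome] on [upper]; the additive form avoids truncated subtraction. *)
Lemma dim_constructionC : (1 < n)%N ->
  (\dim (constructionC u v) + 3 = (n * (n + 1)) %/ 2)%N.
Proof.
move=> n1; rewrite -(dim_upper F) -(limg_ker_dim (linfun syndrome) (upper F n)).
rewrite syndrome_surjective // dimvf; congr (\dim _ + _)%N.
by apply/vspaceP => A; rewrite memv_cap memv_ker lfunE mem_constructionC.
Qed.

Lemma constructionC_fr_ge3 M : M \in constructionC u v -> M != 0 -> (3 <= fr M)%N.
Proof.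
rewrite mem_constructionC => /andP[/supported_onP Mu /eqP M0] nzM.
rewrite leqNgt; apply/negP => M2; have [u0 _ _ vline] := uv.
have suppM : (#|flag_supp M| <= 2)%N := leq_trans (card_flag_supp M) M2.
have suppI i j : M i j != 0 -> i \in flag_supp M /\ j \in flag_supp M.
  move=> Mij; have ij : (i <= j)%N by apply: contraR Mij => /Mu->.
  by split; apply: (mem_flag_supp Mij); rewrite leqnn ij.
(* Two distinct indices exhaust a flag support of size at most 2. *)
have notin3 i j k : i \in flag_supp M -> j \in flag_supp M -> k \in flag_supp M ->
    i != j -> k \in [:: i; j].
  move=> iM jM kM ij; apply: contraTT suppM; rewrite !inE negb_or -ltnNge => /andP[ki kj].
  have kij : uniq [:: k; i; j] by rewrite /= !inE (negPf ki) (negPf kj) ij.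
  rewrite -(card_uniqP kij : _ = 3%N); apply/subset_leq_card/subsetP => x.
  by rewrite !in_cons in_nil orbF => /or3P[] /eqP->.
have unscale (W : {vspace 'cV[F]_3}) (a : F) w : a != 0 -> a *: w \in W -> w \in W.
  by move=> a0 /(memvZ a^-1); rewrite scalerA mulVf // scale1r.
have sumW (I : finType) (W : {vspace 'cV[F]_3}) (P : pred I) (a : I -> F) w :
    (forall k, P k -> a k != 0 -> w k \in W) -> \sum_(k | P k) a k *: w k \in W.
  move=> wW; apply: memv_suml => k Pk; have [->|ak] := eqVneq (a k) 0.
    by rewrite scale0r mem0v.
  by rewrite memvZ // wW.
have [/existsP[i Mi]|/existsPn M_sup] :=
    boolP [exists i : 'I_n.-1, M (ord_cur i) (ord_succ i) != 0].
  have [cM sM] := suppI _ _ Mi.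
  have cs : ord_cur i != ord_succ i by rewrite -val_eqE /= ltn_eqF.
  have /negP := vline i; apply; apply: unscale Mi _.
  (* Solving the zero syndrome for the [v i] term puts [v i] on the forbidden line, provided all
     other terms lie there. *)
  move: M0; rewrite /syndrome addrC (bigD1 i) //= -addrA => /eqP; rewrite addr_eq0 => /eqP->.
  rewrite rpredN; apply: memvD; apply: sumW.
    (* A second superdiagonal entry at [j] would need both [j] and [j + 1] among [i] and [i + 1],
       forcing [j = i]. *)
    move=> j ji Mj; have [cjM sjM] := suppI _ _ Mj; case/eqP: ji; apply: val_inj.
    have := notin3 _ _ _ cM sM cjM cs; have := notin3 _ _ _ cM sM sjM cs.
    by rewrite !inE -!val_eqE /=; lia.
  move=> k _ Mk; have [kM _] := suppI _ _ Mk; have := notin3 _ _ _ cM sM kM cs.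
  rewrite !inE => /orP[] /eqP->; apply: subvP (memv_line _); first exact: addvSl.
  exact: addvSr.
have /matrix0Pn[i [j Mij]] := nzM.
(* The interval bound gives [j <= i + 1], and the superdiagonal is now zero, so the nonzero entry is
   diagonal. *)
have Mi : M i i != 0.
  have [ij|ij] := eqVneq i j; first by rewrite {2}ij.
  have i_le_j : (i <= j)%N by apply: contraR Mij => /Mu->.
  have j_le_i := leq_trans (flag_rank_ge_interval Mij) (M2 : fr M <= 2)%N.
  have i_n : (i < n.-1)%N by move: ij; rewrite -val_eqE /=; have := ltn_ord j; lia.
  case/negP: (M_sup (Ordinal i_n)); rewrite (_ : ord_cur _ = i); last exact: val_inj.
  rewrite (_ : ord_succ _ = j) //; apply: val_inj => /=.
  by move: ij; rewrite -val_eqE /=; lia.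
have ui_in (W : {vspace 'cV[F]_3}) :
    (forall k, k != i -> M k k != 0 -> u k \in W) -> u i \in W.
  move=> uW; apply: (unscale _ _ _ Mi); move: M0; rewrite /syndrome (bigD1 i) //=.
  rewrite [X in _ + X]big1 => [|k _]; last by rewrite (eqP (negPn (M_sup k))) scale0r.
  by rewrite addr0 => /eqP; rewrite addr_eq0 => /eqP->; rewrite rpredN; apply: sumW.
(* With a second diagonal entry at [k], [ui_in] makes [u i] a multiple of [u k]; with none, it puts
   [u i] in the zero space. *)
have [/existsP[k /andP[ki Mk]]|/existsPn Mdiag] := boolP [exists k, (k != i) && (M k k != 0)].
  case/eqP: (ki); apply/esym/admissible_colinear/ui_in => l li Ml.
  have [[[iM _] [kM _]] [lM _]] := (suppI _ _ Mi, suppI _ _ Mk, suppI _ _ Ml).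
  have ik : i != k by rewrite eq_sym.
  by have := notin3 _ _ _ iM kM lM ik; rewrite !inE (negPf li) => /eqP->; rewrite memv_line.
have := u0 i; rewrite -memv0 ui_in // => k ki Mk.
by have := Mdiag k; rewrite ki Mk.
Qed.

End ConstructionC.

Theorem theorem5p8 (F : finFieldType) (n : nat)
    (hn : n = (#|F| ^ 2 + #|F| + 1)%N)
    (u : 'I_n -> 'cV[F]_3) (v : 'I_n.-1 -> 'cV[F]_3)
    (huv : admissible u v) :
  let C := constructionC u v in
  [/\ flag_rank_code C, nontrivial C, perfect C, min_dist C = 3%N & codim C = 3%N].
Proof.
set C := constructionC u v => /=; have q1 : (1 < #|F|)%N := finNzRing_gt1 F.
have n2 : (2 < n)%N by rewrite hn; lia.
have dimC := dim_constructionC huv (ltnW n2).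
(* Position (1, 3) is [(0, 2)] when counting from 0. *)
pose i0 := Ordinal (ltnW (ltnW n2)); pose E : 'M[F]_n := delta_mx i0 (Ordinal n2).
have E0 : E != 0.
  apply/eqP => /matrixP/(_ i0 (Ordinal n2))/eqP.
  by rewrite !mxE !eqxx oner_eq0.
have EC : E \in C by apply: (subvP (addvSr _ _)); apply: supported_on_delta.
have frE : (fr E <= 3)%N by rewrite -[E]scale1r fr_scale_delta.
have C0 : C != 0%VS by apply: contraNneq E0 => C0; rewrite -memv0 -C0.
have distC : min_dist C = 3%N.
  apply/(min_distP _ C0); split=> [|M]; last exact: constructionC_fr_ge3.
  by exists E; rewrite ?EC //; apply/eqP; rewrite eqn_leq frE (constructionC_fr_ge3 huv).
split=> //.
- by apply/subvP => A; rewrite mem_constructionC => /andP[].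
- by apply/eqP => CU; move: dimC; rewrite -/C CU dim_upper; lia.
(* The radius is (3 - 1) / 2 = 1; what remains is (q^2 + q + 1)(q - 1) + 1 = q^3. *)
- split=> //; rewrite distC ball_size1 cardsE card_vspace -dimC expnD; congr (_ * _)%N.
  by rewrite hn; lia.
- by rewrite /codim -dimC addKn.
Qed.
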